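(* Let $K$ be a field of characteristic $0$ and let $\alpha\in K$. If $\alpha^3=1$ and $\epsilon\in K$ is a root of the equation $\lambda^2+\lambda+1=0$, then the automorphisms $\psi_\gamma$ ($\gamma\in K^*$) and $\sigma'$ generate $\mathrm{Aut}\,E_\alpha$, and $$\mathrm{Aut}\,E_\alpha\cong(K^* )^3\rtimes Z_3 .$$
   Context: For $\alpha\in K$ put $C=\frac13(x^3+y^3+z^3)-\alpha xyz\in K[x,y,z]$. The elliptic Poisson algebra $E_\alpha$ is the polynomial algebra $K[x,y,z]$ endowed with the Poisson bracket determined by $\{x,y\}=-\alpha xy+z^2$, $\{y,z\}=-\alpha yz+x^2$, $\{z,x\}=-\alpha zx+y^2$; equivalently $\{u,v\}=J(u,v,C)$ for all $u,v\in K[x,y,z]$, where $J(f_1,f_2,f_3)$ is the determinant of the Jacobian matrix of $(f_1,f_2,f_3)$ with respect to $(x,y,z)$. An automorphism of a Poisson algebra $P$ over $K$ is a bijective $K$-linear map $\phi:P\to P$ with $\phi(ab)=\phi(a)\phi(b)$ and $\phi(\{a,b\})=\{\phi(a),\phi(b)\}$ for all $a,b\in P$. $\mathrm{Aut}\,E_\alpha$ is the group of automorphisms of $E_\alpha$ as a Poisson algebra. $K^*$ is the multiplicative group of $K$ and $Z_3$ is the cyclic group of order $3$. When $\alpha^3=1$ and $\epsilon\in K$ is a root of $\lambda^2+\lambda+1=0$, put $u=x+y+\alpha z$, $v=\epsilon x+\epsilon^2y+\alpha z$, $w=\epsilon^2x+\epsilon y+\alpha z$; then $K[x,y,z]=K[u,v,w]$.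 The automorphisms $\psi_\gamma$ ($\gamma\in K^*$) and $\sigma'$ of $E_\alpha$ are defined by $\psi_\gamma(u)=\gamma u$, $\psi_\gamma(v)=v$, $\psi_\gamma(w)=w$ and $\sigma'(u)=v$, $\sigma'(v)=w$, $\sigma'(w)=u$. *)

(* Defs.v *)
(* boolp is used to make the type of Poisson automorphisms a
   choiceType, hence a groupType, and to compare automorphisms pointwise. *)
From HB Require Import structures.
From mathcomp Require Import all_boot all_order all_algebra.
From mathcomp Require Import boolp mpoly ring.

Set Implicit Arguments.
Unset Strict Implicit.
Unset Printing Implicit Defensive.

Import GRing.Theory.
Local Open Scope ring_scope.

HB.mixin Record ComAlgebra_isPoisson (K : comNzRingType) P
    of GRing.ComAlgebra K P := {
  pbracket : P -> P -> P;
  pbracket_linearl : forall b, linear (pbracket^~ b);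
  pbracketxx : forall a, pbracket a a = 0;
  pbracketMl : forall a b c,
    pbracket (a * b) c = a * pbracket b c + pbracket a c * b;
  pbracket_jacobi : forall a b c,
    pbracket a (pbracket b c) + pbracket b (pbracket c a)
      + pbracket c (pbracket a b) = 0
}.

#[short(type="poissonAlgType")]
HB.structure Definition PoissonAlgebra (K : comNzRingType) :=
  { P of GRing.ComAlgebra K P & ComAlgebra_isPoisson K P }.

Section PoissonAut.
Variables (K : comNzRingType) (P : poissonAlgType K).

(* Preservation of 1 is automatic: f is multiplicative and surjective. *)
Definition is_poisson_aut (f : P -> P) : Prop :=
  [/\ bijective f, linear f, {morph f : a b / a * b}
    & {morph f : a b / pbracket a b}].

Record poisson_aut := PoissonAut {
  poisson_aut_fun :> P -> P;
  poisson_autP : is_poisson_aut poisson_aut_fun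
}.

HB.instance Definition _ := gen_eqMixin poisson_aut.
HB.instance Definition _ := gen_choiceMixin poisson_aut.

Lemma poisson_aut_eq (f g : poisson_aut) : f =1 g -> f = g.
Proof.
case: f g => [f fP] [g gP] /= /funext fg.
by move: gP; rewrite -fg => gP; rewrite (Prop_irrelevance fP gP).
Qed.

Lemma is_poisson_aut_id : is_poisson_aut idfun.
Proof. by split=> //; exists idfun. Qed.

Lemma is_poisson_aut_comp (f g : P -> P) :
  is_poisson_aut f -> is_poisson_aut g -> is_poisson_aut (f \o g).
Proof.
move=> [fb fl fm fp] [gb gl gm gp]; split.
- exact: bij_comp.
- by move=> k a b /=; rewrite gl fl.
- by move=> a b /=; rewrite gm fm.
- by move=> a b /=; rewrite gp fp.
Qed.

Lemma poisson_aut_surj (f : poisson_aut) (b : P) : exists a, f a == b.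
Proof.
by have [[g _ gK] _ _ _] := poisson_autP f; exists (g b); rewrite gK.
Qed.

Definition poisson_aut_invf (f : poisson_aut) (b : P) : P :=
  xchoose (poisson_aut_surj f b).

Lemma poisson_aut_invfK (f : poisson_aut) : cancel (poisson_aut_invf f) f.
Proof. by move=> b; apply/eqP/(xchooseP (poisson_aut_surj f b)). Qed.

Lemma poisson_autK (f : poisson_aut) : cancel f (poisson_aut_invf f).
Proof.
have [/bij_inj fI _ _ _] := poisson_autP f.
by move=> a; apply: fI; rewrite poisson_aut_invfK.
Qed.

Lemma is_poisson_aut_inv (f : poisson_aut) :
  is_poisson_aut (poisson_aut_invf f).
Proof.
have [/bij_inj fI fl fm fp] := poisson_autP f.
have fK := @poisson_aut_invfK f; have Kf := @poisson_autK f.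
split; first by exists f.
- by move=> k a b; apply: fI; rewrite fl !fK.
- by move=> a b; apply: fI; rewrite fm !fK.
- by move=> a b; apply: fI; rewrite fp !fK.
Qed.

Definition poisson_aut_one := PoissonAut is_poisson_aut_id.
Definition poisson_aut_mul (f g : poisson_aut) :=
  PoissonAut (is_poisson_aut_comp (poisson_autP f) (poisson_autP g)).
Definition poisson_aut_inv (f : poisson_aut) :=
  PoissonAut (is_poisson_aut_inv f).

Fact poisson_aut_mulA : associative poisson_aut_mul.
Proof. by move=> f g h; apply: poisson_aut_eq. Qed.
Fact poisson_aut_mul1 : left_id poisson_aut_one poisson_aut_mul.
Proof. by move=> f; apply: poisson_aut_eq. Qed.
Fact poisson_aut_mulr1 : right_id poisson_aut_one poisson_aut_mul.
Proof. by move=> f; apply: poisson_aut_eq. Qed.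
Fact poisson_aut_mulV :
  left_inverse poisson_aut_one poisson_aut_inv poisson_aut_mul.
Proof. by move=> f; apply: poisson_aut_eq => a /=; rewrite poisson_autK. Qed.
Fact poisson_aut_mulrV :
  right_inverse poisson_aut_one poisson_aut_inv poisson_aut_mul.
Proof.
by move=> f; apply: poisson_aut_eq => a /=; rewrite poisson_aut_invfK.
Qed.

(* The product f * g is the composite f \o g. *)
HB.instance Definition _ := isGroup.Build poisson_aut
  poisson_aut_mulA poisson_aut_mul1 poisson_aut_mulr1
  poisson_aut_mulV poisson_aut_mulrV.

End PoissonAut.

Fact jacobian_scaleD (R : comNzRingType) (k x1 x2 x3 y1 y2 y3 a b c : R) :
  (k * x1 + y1) * a - (k * x2 + y2) * b + (k * x3 + y3) * c =
  k * (x1 * a - x2 * b + x3 * c) + (y1 * a - y2 * b + y3 * c).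
Proof. ring. Qed.

Fact jacobian_jacobi (R : comNzRingType) (dx dy dz : R -> R)
    (D := fun d : R -> R => [/\ {morph d : p q / p + q},
       {morph d : p / - p} & forall p q, d (p * q) = d p * q + p * d q])
    (J := fun f g h =>
       dx f * (dy g * dz h - dz g * dy h)
       - dy f * (dx g * dz h - dz g * dx h)
       + dz f * (dx g * dy h - dy g * dx h)) (f g h c : R) :
  D dx -> D dy -> D dz ->
  (forall p, dy (dx p) = dx (dy p)) -> (forall p, dz (dx p) = dx (dz p)) ->
  (forall p, dz (dy p) = dy (dz p)) ->
  J f (J g h c) c + J g (J h f c) c + J h (J f g c) c = 0.
Proof.
move=> [xD xN xM] [yD yN yM] [zD zN zM] yx zx zy.
rewrite /J !(xD, xN, xM, yD, yN, yM, zD, zN, zM) !(yx, zx, zy).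
ring.
Qed.

Section Elliptic.
Variable K : fieldType.
Implicit Types (f g h : {mpoly K[3]}) (alpha : K).

(* The variables x, y, z are 'X_0, 'X_1, 'X_2. *)
Definition jacobian3 f g h : {mpoly K[3]} :=
  \det (\matrix_(i < 3, j < 3) ([:: f; g; h]`_i)^`M(j)).

Definition elliptic_C alpha : {mpoly K[3]} :=
  3^-1 *: ('X_0 ^+ 3 + 'X_1 ^+ 3 + 'X_2 ^+ 3)
    - alpha *: ('X_0 * 'X_1 * 'X_2).

Lemma jacobian3E f g h : jacobian3 f g h =
  f^`M(0) * (g^`M(1) * h^`M(2) - g^`M(2) * h^`M(1))
  - f^`M(1) * (g^`M(0) * h^`M(2) - g^`M(2) * h^`M(0))
  + f^`M(2) * (g^`M(0) * h^`M(1) - g^`M(1) * h^`M(0)).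
Proof.
have d2 (A : 'M[{mpoly K[3]}]_2) :
    \det A = A ord0 ord0 * A ord_max ord_max - A ord0 ord_max * A ord_max ord0.
  rewrite (expand_det_row _ ord0) !big_ord_recl big_ord0 /cofactor !det_mx11 !mxE /=.
  have -> : lift ord0 ord0 = ord_max :> 'I_2 by apply: val_inj.
  have -> : lift ord_max ord0 = ord0 :> 'I_2 by apply: val_inj.
  by rewrite addr0 expr0 expr1 mul1r mulN1r mulrN.
rewrite /jacobian3 (expand_det_row _ ord0) !big_ord_recl big_ord0 /cofactor.
rewrite !d2 !mxE /= /bump /=.
have -> : lift ord0 ord0 = 1 :> 'I_3 by apply: val_inj.
have -> : lift ord0 ord_max = 2 :> 'I_3 by apply: val_inj.
have -> : lift 1 ord0 = 0 :> 'I_3 by apply: val_inj.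
have -> : lift 1 ord_max = 2 :> 'I_3 by apply: val_inj.
have -> : lift ord0 (lift ord0 ord0) = 2 :> 'I_3 by apply: val_inj.
have -> : lift 2 ord0 = 0 :> 'I_3 by apply: val_inj.
have -> : lift 2 ord_max = 1 :> 'I_3 by apply: val_inj.
rewrite -[ord0]/(0 : 'I_3) !addn0 !add0n; ring.
Qed.

Definition elliptic_bracket alpha f g := jacobian3 f g (elliptic_C alpha).

Fact elliptic_bracket_linearl alpha g :
  linear ((elliptic_bracket alpha)^~ g).
Proof.
move=> k f h; rewrite /elliptic_bracket !jacobian3E !(mderivD, mderivZ).
by rewrite -!mul_mpolyC jacobian_scaleD.
Qed.

Fact elliptic_bracketxx alpha f : elliptic_bracket alpha f f = 0.
Proof. by rewrite /elliptic_bracket jacobian3E; ring. Qed.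

Fact elliptic_bracketMl alpha f g h :
  elliptic_bracket alpha (f * g) h =
  f * elliptic_bracket alpha g h + elliptic_bracket alpha f h * g.
Proof. rewrite /elliptic_bracket !jacobian3E !mderivM; ring. Qed.

Fact elliptic_bracket_jacobi alpha f g h :
  elliptic_bracket alpha f (elliptic_bracket alpha g h)
  + elliptic_bracket alpha g (elliptic_bracket alpha h f)
  + elliptic_bracket alpha h (elliptic_bracket alpha f g) = 0.
Proof.
rewrite /elliptic_bracket !jacobian3E.
have D (i : 'I_3) : [/\ {morph @mderiv 3 K i : p q / p + q},
    {morph @mderiv 3 K i : p / - p} & forall p q : {mpoly K[3]},
    (p * q)^`M(i) = p^`M(i) * q + p * q^`M(i)].
  by split; [exact: mderivD | exact: mderivN | exact: mderivM].
exact: (jacobian_jacobi f g h _ (D 0) (D 1) (D 2)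
  (@mderiv_comm _ _ _ _) (@mderiv_comm _ _ _ _) (@mderiv_comm _ _ _ _)).
Qed.

(* The phantom parameter alpha selects the bracket. *)
Definition elliptic alpha : Type := {mpoly K[3]}.

HB.instance Definition _ alpha :=
  GRing.ComAlgebra.copy (elliptic alpha) {mpoly K[3]}.
HB.instance Definition _ alpha :=
  ComAlgebra_isPoisson.Build K (elliptic alpha)
    (elliptic_bracket_linearl alpha) (elliptic_bracketxx alpha)
    (elliptic_bracketMl alpha) (elliptic_bracket_jacobi alpha).

Definition ell_x alpha : elliptic alpha := 'X_0.
Definition ell_y alpha : elliptic alpha := 'X_1.
Definition ell_z alpha : elliptic alpha := 'X_2.

End Elliptic.

Section EllipticGens.
Variables (K : fieldType) (alpha : K).

Lemma mderiv_var (i j : 'I_3) : ('X_i : {mpoly K[3]})^`M(j) = (i == j)%:R.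
Proof.
rewrite mderivX mnm1E; case: eqP => [->|_]; last by rewrite scale0r.
by rewrite scale1r -[X in (X - _)%MM]add0m addmK mpolyX0.
Qed.

Let x := ell_x alpha.
Let y := ell_y alpha.
Let z := ell_z alpha.

Lemma elliptic_bracket_gens : 3 != 0 :> K ->
  [/\ pbracket x y = - alpha *: (x * y) + z ^+ 2,
      pbracket y z = - alpha *: (y * z) + x ^+ 2
    & pbracket z x = - alpha *: (z * x) + y ^+ 2].
Proof.
move=> K3; have K3' (p : {mpoly K[3]}) : 3^-1 *: (p * 3) = p.
  have -> : 3 = (3 : K)%:MP :> {mpoly K[3]} by rewrite mpolyC_nat.
  by rewrite mulrC mul_mpolyC scalerA mulVf // scale1r.
pose X (i : 'I_3) : {mpoly K[3]} := 'X_i.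
have dX (i j : 'I_3) : (X j ^+ 3)^`M(i) = (X j ^+ 2 * (j == i)%:R) * 3.
  by rewrite !exprS expr0 !mderivM mderiv_var mderivC; ring.
have dC i : (elliptic_C alpha)^`M(i) =
    X 0 ^+ 2 * (0 == i)%:R + X 1 ^+ 2 * (1 == i)%:R + X 2 ^+ 2 * (2 == i)%:R
    - alpha%:MP * (((0 == i)%:R * X 1 + X 0 * (1 == i)%:R) * X 2
                   + X 0 * X 1 * (2 == i)%:R).
  rewrite /elliptic_C mderivB !mderivZ !mderivD !dX !mderivM !mderiv_var.
  by rewrite -!mulrDl K3' mul_mpolyC.
rewrite /pbracket /= /elliptic_bracket !jacobian3E !dC !mderiv_var.
rewrite -!mul_mpolyC mpolyCN /x /y /z /ell_x /ell_y /ell_z -!/(X _).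
rewrite !eqxx ![1 == _]eq_sym ![2 == _]eq_sym /=.
rewrite !(mulr0, mul0r, mulr1, mul1r, addr0, add0r, subr0, sub0r, oppr0).
by split; rewrite ?opprK mulNr [RHS]addrC // [X 2 * X 0]mulrC.
Qed.

Lemma elliptic_aut_xyz (phi psi : poisson_aut (elliptic alpha)) :
  phi x = psi x -> phi y = psi y -> phi z = psi z -> phi = psi.
Proof.
move=> ex ey ez; apply: poisson_aut_eq.
have H1 (f : poisson_aut (elliptic alpha)) : f 1 = 1.
  have [[g _ gK] _ fM _] := poisson_autP f.
  by rewrite -[LHS]mulr1 -{2}[1]gK -fM mul1r gK.
have [_ l1 m1 _] := poisson_autP phi; have [_ l2 m2 _] := poisson_autP psi.
have linE (f : elliptic alpha -> elliptic alpha) : linear f ->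
    f 0 = 0 /\ forall c a b, f (c *: a + b) = c *: f a + f b.
  move=> fl; split=> //; have := fl (-1) 0 0.
  by rewrite scaler0 addr0 scaleN1r addNr.
have [z1 {}l1] := linE _ l1; have [z2 {}l2] := linE _ l2.
apply: mpolyind => [|c m q _ _ IH]; first by rewrite z1 z2.
rewrite (l1 c 'X_[m]) (l2 c 'X_[m]) IH; congr (_ *: _ + _).
pose P (p : elliptic alpha) := phi p = psi p.
have PM a b : P a -> P b -> P (a * b) by rewrite /P m1 m2 => -> ->.
have P1 : P 1 by rewrite /P !H1.
rewrite -/(P _) mpolyXE_id; apply: (big_ind P) => // i _.
have Pi : P 'X_i.
  case: i => -[|[|[|//]]] lti.
  - by rewrite (_ : Ordinal lti = 0) //; apply: val_inj.
  - by rewrite (_ : Ordinal lti = 1) //; apply: val_inj.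
  - by rewrite (_ : Ordinal lti = 2) //; apply: val_inj.
by elim: (m i) => [|k IHk]; rewrite ?expr0 // exprS; apply: PM.
Qed.
End EllipticGens.

Section EllipticUVW.
Variables (K : fieldType) (alpha eps : K).
Definition ell_u : elliptic alpha :=
  ell_x alpha + ell_y alpha + alpha *: ell_z alpha.
Definition ell_v : elliptic alpha :=
  eps *: ell_x alpha + eps ^+ 2 *: ell_y alpha + alpha *: ell_z alpha.
Definition ell_w : elliptic alpha :=
  eps ^+ 2 *: ell_x alpha + eps *: ell_y alpha + alpha *: ell_z alpha.

Hypotheses (K3 : 3 != 0 :> K) (alpha0 : alpha != 0).
Hypothesis eps_root : eps ^+ 2 + eps + 1 = 0.

Lemma elliptic_aut_uvw (phi psi : poisson_aut (elliptic alpha)) :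
  phi ell_u = psi ell_u -> phi ell_v = psi ell_v -> phi ell_w = psi ell_w ->
  phi = psi.
Proof.
move=> eu ev ew.
have [_ l1 _ _] := poisson_autP phi; have [_ l2 _ _] := poisson_autP psi.
have agree (c d e k : K) (t : elliptic alpha) : k != 0 ->
    k *: t = c *: ell_u + (d *: ell_v + (e *: ell_w + 0)) -> phi t = psi t.
  move=> k0 tE; apply: (scalerI k0).
  have lin (f : elliptic alpha -> elliptic alpha) :
      linear f -> k *: f t = c *: f ell_u + (d *: f ell_v + e *: f ell_w).
    move=> fl; have f0 : f 0 = 0.
      by have := fl (-1) 0 0; rewrite scaler0 addr0 scaleN1r addNr.
    have -> : k *: f t = f (k *: t) by rewrite -[k *: t]addr0 fl f0 addr0.
    by rewrite tE !fl f0 addr0.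
  by rewrite !lin // eu ev ew.
have e2 : eps ^+ 2 = - eps - 1 by rewrite -[LHS]subr0 -eps_root; ring.
pose e : {mpoly K[3]} := eps%:MP; pose a : {mpoly K[3]} := alpha%:MP.
have E : e ^+ 2 = - e - 1.
  by rewrite /e expr2 -mpolyCM -expr2 e2 mpolyCB mpolyCN mpolyC1.
have C3 : (3 : K)%:MP = 3 :> {mpoly K[3]} by rewrite mpolyC_nat.
apply: elliptic_aut_xyz.
- apply: (agree 1 (- eps - 1) eps 3) => //.
  rewrite addr0 /ell_u /ell_v /ell_w e2 -!mul_mpolyC mpolyCB mpolyCN mpolyC1 C3.
  rewrite /ell_x /ell_y /ell_z -/e -/a.
  ring: E.
- apply: (agree 1 eps (- eps - 1) 3) => //.
  rewrite addr0 /ell_u /ell_v /ell_w e2 -!mul_mpolyC mpolyCB mpolyCN mpolyC1 C3.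
  rewrite /ell_x /ell_y /ell_z -/e -/a.
  ring: E.
- apply: (agree 1 1 1 (3 * alpha)); first by rewrite mulf_neq0.
  rewrite addr0 /ell_u /ell_v /ell_w e2 -!mul_mpolyC mpolyCB mpolyCN mpolyC1.
  rewrite mpolyCM C3 /ell_x /ell_y /ell_z -/e -/a.
  ring.
Qed.
End EllipticUVW.

Section Kstar.
Variable K : fieldType.

Definition Kstar : Type := {c : K | c != 0}.
HB.instance Definition _ := Choice.copy Kstar {c : K | c != 0}.

Definition Kstar_one : Kstar := exist _ 1 (oner_neq0 K).
Definition Kstar_mul (a b : Kstar) : Kstar :=
  exist _ (sval a * sval b) (mulf_neq0 (svalP a) (svalP b)).
Definition Kstar_inv (a : Kstar) : Kstar :=
  exist _ (sval a)^-1 (invr_neq0 (svalP a)).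

Fact Kstar_mulA : associative Kstar_mul.
Proof. by move=> a b c; apply: val_inj; rewrite /= mulrA. Qed.
Fact Kstar_mul1 : left_id Kstar_one Kstar_mul.
Proof. by move=> a; apply: val_inj; rewrite /= mul1r. Qed.
Fact Kstar_mulr1 : right_id Kstar_one Kstar_mul.
Proof. by move=> a; apply: val_inj; rewrite /= mulr1. Qed.
Fact Kstar_mulV : left_inverse Kstar_one Kstar_inv Kstar_mul.
Proof. by move=> a; apply: val_inj; rewrite /= mulVf ?(svalP a). Qed.
Fact Kstar_mulrV : right_inverse Kstar_one Kstar_inv Kstar_mul.
Proof. by move=> a; apply: val_inj; rewrite /= mulfV ?(svalP a). Qed.

HB.instance Definition _ := isGroup.Build Kstar
  Kstar_mulA Kstar_mul1 Kstar_mulr1 Kstar_mulV Kstar_mulrV.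
End Kstar.

Section GroupTheory.
Local Open Scope group_scope.

Record group_act (N H : groupType) := GroupAct {
  group_act_fun :> H -> N -> N;
  group_act1 : forall n, group_act_fun 1 n = n;
  group_actM : forall a b n,
    group_act_fun (a * b) n = group_act_fun a (group_act_fun b n);
  group_act_morph : forall a, {morph group_act_fun a : m n / m * n}
}.

Definition semidirect (N H : groupType) (to : group_act N H) : Type :=
  (N * H)%type.

Section Semidirect.
Variables (N H : groupType) (to : group_act N H).
Local Notation T := (semidirect to).
HB.instance Definition _ := Choice.copy T (N * H)%type.

Definition semidirect_one : T := (1, 1).
Definition semidirect_mul (p q : T) : T := (p.1 * to p.2 q.1, p.2 * q.2).
Definition semidirect_inv (p : T) : T := (to p.2^-1 p.1^-1, p.2^-1).

Lemma group_act_one a : to a 1 = 1.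
Proof. by apply: (mulgI (to a 1)); rewrite -group_act_morph !mulg1. Qed.

Fact semidirect_mulA : associative semidirect_mul.
Proof.
move=> [n1 h1] [n2 h2] [n3 h3]; congr (_, _) => /=; last exact: mulgA.
by rewrite group_act_morph group_actM mulgA.
Qed.
Fact semidirect_mul1 : left_id semidirect_one semidirect_mul.
Proof.
by case=> n h; rewrite /semidirect_mul /= group_act1 !mul1g.
Qed.
Fact semidirect_mulr1 : right_id semidirect_one semidirect_mul.
Proof.
by case=> n h; rewrite /semidirect_mul /= group_act_one !mulg1.
Qed.
Fact semidirect_mulV :
  left_inverse semidirect_one semidirect_inv semidirect_mul.
Proof.
case=> n h; rewrite /semidirect_mul /= mulVg -group_act_morph mulVg.
by rewrite group_act_one.
Qed.
Fact semidirect_mulrV :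
  right_inverse semidirect_one semidirect_inv semidirect_mul.
Proof.
case=> n h; rewrite /semidirect_mul /= -group_actM !mulgV group_act1.
by rewrite mulgV.
Qed.

HB.instance Definition _ := isGroup.Build T semidirect_mulA
  semidirect_mul1 semidirect_mulr1 semidirect_mulV semidirect_mulrV.
End Semidirect.

Section CyclicShift.
Variable G : groupType.

(* If sigma u = v, sigma v = w, sigma w = u, then conjugation by sigma (for
   composition of maps) turns the scaling u, v, w |-> t 0 u, t 1 v, t 2 w into
   the one with parameters cyclic_shift 1%R t. *)
Definition cyclic_shift (k : 'Z_3) (t : {ffun 'Z_3 -> G}) : {ffun 'Z_3 -> G} :=
  [ffun i => t (i - k)%R].

Fact cyclic_shift1 t : cyclic_shift 1 t = t.
Proof. by apply/ffunP => i; rewrite ffunE subr0. Qed.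
Fact cyclic_shiftM j k t :
  cyclic_shift (j * k) t = cyclic_shift j (cyclic_shift k t).
Proof. by apply/ffunP => i; rewrite !ffunE opprD addrA. Qed.
Fact cyclic_shift_morph k : {morph cyclic_shift k : s t / s * t}.
Proof. by move=> s t; apply/ffunP => i; rewrite !ffunE. Qed.

Definition cyclic_shift_act : group_act {ffun 'Z_3 -> G} 'Z_3 :=
  GroupAct cyclic_shift1 cyclic_shiftM cyclic_shift_morph.
End CyclicShift.

Definition generates (G : groupType) (S : G -> Prop) : Prop :=
  forall H : G -> Prop,
    H 1 -> (forall a b, H a -> H b -> H (a * b)) ->
    (forall a, H a -> H a^-1) -> (forall s, S s -> H s) ->
  forall g, H g.

Definition group_isomorphic (G H : groupType) : Prop :=
  exists2 f : G -> H, bijective f & {morph f : a b / a * b}.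

End GroupTheory.

(* Main.v *)
Require Import Defs.
From HB Require Import structures.
From mathcomp Require Import all_boot all_order all_algebra.
From mathcomp Require Import boolp mpoly ring zify.

Set Implicit Arguments.
Unset Strict Implicit.
Unset Printing Implicit Defensive.

Import GRing.Theory.
Local Open Scope ring_scope.

(** When alpha ^ 3 = 1 the cubic C factors as u v w / 3, so in the coordinates
    u, v, w the bracket is log-canonical: {t i, t (i + 1)} = c t i t (i + 1),
    where t = (u, v, w) is indexed cyclically and c = alpha (eps ^ 2 - eps) is
    nonzero ([uvw_bracket]). Hence rescaling u, v, w independently and
    permuting them cyclically are Poisson automorphisms, and these compose as
    in the semidirect product ([monomial_autM]). What has to be shown is that
    nothing else preserves the bracket ([aut_uvw_cyclic]).

    Let phi be an automorphism and f = phi (t i). Since t i divides every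
    bracket {t i, b}, the image f divides every {f, b}. Write f = p(u, v, w).
    Bracketing with t j acts on p as the derivation
    X_(j-1) d/dX_(j-1) - X_(j+1) d/dX_(j+1) followed by multiplication by
    c X_j ([bracket_of_uvw]), so p divides X_j times its image under this
    derivation. As X_j is prime and is killed by the derivation, comparing
    degrees shows that p is an eigenvector ([var_dvd_eigenvector]). The
    derivation is diagonal on monomials; in characteristic 0 its eigenvalues
    for the three values of j force all exponents of p to differ by multiples
    of (1, 1, 1) ([normal_diag]).

    Now apply the inverse of phi: t i is obtained by substituting nonconstant
    polynomials in p. The monomials of p form a chain for divisibility, so
    after substitution the largest one still dominates, and
    deg p <= deg (t i) = 1 ([leq_msize_comp]). A polynomial of degree 1 with
    such a support is a multiple of one variable, thus phi (t i) is a multiple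
    of some t j. Finally, preserving the bracket, hence the sign of c, forces
    the induced map on indices to commute with i |-> i + 1, so it is a
    translation. *)

(** * Polynomials in several variables *)

Section PolynomialAlgebra.
Variables (n : nat) (R : comNzRingType).

Lemma mpoly_alg_ind (P : {mpoly R[n]} -> Prop) :
  P 1 -> (forall k p q, P p -> P q -> P (k *: p + q)) ->
  (forall p q, P p -> P q -> P (p * q)) -> (forall i, P 'X_i) ->
  forall p, P p.
Proof.
move=> P1 PD PM PX.
have P0 : P 0 by have := PD (-1) 1 1 P1 P1; rewrite scaleN1r addNr.
elim/mpolyind=> // k m p _ _ Pp; apply: PD => //.
rewrite mpolyXE_id; apply: (big_ind P) => // i _.
by elim: (m i) => [|j IHj]; rewrite ?expr0 // exprS; apply: PM.
Qed.

Lemma comp_mpolyXi k (g : 'I_n -> {mpoly R[k]}) i :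
  'X_i \mPo [tuple g j | j < n] = g i.
Proof. by rewrite comp_mpolyXU -tnth_nth tnth_mktuple. Qed.

(** Used as the statement that the quotient by 'X_j is again a polynomial
    algebra, which is what makes 'X_j prime over an integral domain. *)
Lemma mpoly_mod_var j (p : {mpoly R[n]}) : exists q,
  p = p \mPo [tuple if i == j then 0 else 'X_i | i < n] + 'X_j * q.
Proof.
move: p; apply: mpoly_alg_ind.
- by exists 0; rewrite comp_mpoly1 mulr0 addr0.
- move=> k p q [p' ep] [q' eq]; exists (k *: p' + q').
  rewrite comp_mpolyD comp_mpolyZ {1}ep {1}eq.
  by rewrite scalerDr mulrDr scalerAr addrACA.
- move=> p q; set s := [tuple _ | _ < _] => -[p' ep] [q' eq].
  exists (p' * (q \mPo s) + (p \mPo s) * q' + 'X_j * p' * q').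
  by rewrite rmorphM /= {1}ep {1}eq; ring.
- move=> i; rewrite comp_mpolyXi; case: eqP => [->|_]; last by exists 0; ring.
  by exists 1; ring.
Qed.

Lemma comp_mpolyM k (s : n.-tuple {mpoly R[k]}) p q :
  (p * q) \mPo s = (p \mPo s) * (q \mPo s).
Proof. exact: rmorphM. Qed.

Lemma mcoeff_euler i m (p : {mpoly R[n]}) : ('X_i * p^`M(i))@_m = p@_m *+ m i.
Proof.
rewrite [_ * _]mulrC; case: (posnP (m i)) => [mi0|mi_gt0].
  rewrite mi0 mulr0n; apply: memN_msupp_eq0; apply/negP.
  rewrite (perm_mem (msuppMX _ _)) => /mapP[m' _].
  move/(congr1 (fun q : 'X_{1..n} => q i)).
  by rewrite mnmDE mnm1E eqxx mi0.
have {1}-> : m = (U_(i) + (m - U_(i)))%MM.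
  rewrite addmC submK //; apply/mnm_lepP => k.
  by rewrite mnm1E; case: eqP => // <-.
rewrite mcoeffMX mcoeff_deriv submK; last first.
  by apply/mnm_lepP => k; rewrite mnm1E; case: eqP => // <-.
by rewrite mnmBE mnm1E eqxx subn1 prednK.
Qed.

End PolynomialAlgebra.

Lemma msize_gt0 n (R : nzRingType) (p : {mpoly R[n]}) :
  (0 < msize p)%N = (p != 0).
Proof. by rewrite lt0n msize_poly_eq0. Qed.

(** The exponents differ by an integer multiple of (1, ..., 1), stated without
    subtraction. *)
Definition diag_shift n (m m' : 'X_{1..n}) :=
  forall i j, (m i + m' j = m j + m' i)%N.

Section Degrees.
Variables (n : nat) (R : idomainType).

(** As 'X_j is prime it divides g or p. If it divides g, then p divides d p,
    which has no larger degree, and the quotient is a constant. If it divides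
    p, the same relation holds for p / 'X_j, as d commutes with 'X_j, and the
    degree has dropped. *)
Lemma var_dvd_eigenvector (j : 'I_n) (d : {mpoly R[n]} -> {mpoly R[n]}) :
  (forall p, d ('X_j * p) = 'X_j * d p) ->
  (forall p, (msize (d p) <= msize p)%N) ->
  forall p g, p * g = 'X_j * d p -> exists k, d p = k *: p.
Proof.
move=> dX dsz p; have Xj0 : 'X_j != 0 :> {mpoly R[n]}.
  by rewrite -msize_poly_eq0 msizeX.
have [N] := ubnP (msize p); elim: N p => // N IHN p /ltnSE pN g pg.
have [p0|p0] := eqVneq p 0.
  exists 0; rewrite p0 scaler0; apply/eqP.
  by rewrite -msize_poly_eq0 -leqn0 (leq_trans (dsz 0)) // mmeasure0.
have [p' ep] := mpoly_mod_var j p; have [g' eg] := mpoly_mod_var j g.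
set s := [tuple _ | _ < _] in ep eg.
have : (p \mPo s) * (g \mPo s) = 0.
  by rewrite -comp_mpolyM pg comp_mpolyM comp_mpolyXi eqxx mul0r.
move/eqP; rewrite mulf_eq0 => /orP[] /eqP s0; last first.
  have {}pg : p * g' = d p.
    apply: (mulfI Xj0); rewrite -pg eg s0; ring.
  have [g0|g0] := eqVneq g' 0.
    by exists 0; rewrite -pg g0 mulr0 scale0r.
  suff /msize1_polyC g'E : (msize g' <= 1)%N.
    by exists (g'@_0%MM); rewrite -pg {1}g'E mulrC mul_mpolyC.
  have le1 a b : (0 < a -> 0 < b -> (a + b).-1 <= a -> b <= 1)%N by lia.
  have := dsz p; rewrite -pg msizeM //.
  by move: p0 g0; rewrite -!msize_gt0; apply: le1.
rewrite s0 add0r in ep.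
have p'0 : p' != 0 by apply: contraNneq p0 => p'0; rewrite ep p'0 mulr0.
have [||k dk] := IHN p' _ g.
- apply: leq_trans pN; rewrite ep msizeM // msizeX mdeg1; exact: leqnn.
- by apply: (mulfI Xj0); rewrite mulrA -ep pg ep dX.
by exists k; rewrite ep dX dk scalerAr.
Qed.

Variables (k : nat) (Y : n.-tuple {mpoly R[k]}).
Hypothesis Ysz : forall i, (1 < msize (tnth Y i))%N.

Lemma msize_comp_mnm m : (mdeg m < msize ('X_[m] \mPo Y))%N.
Proof.
pose D (d : nat) (p : {mpoly R[k]}) : Prop := (d < msize p)%N.
have D1 : D 0%N 1 by rewrite /D msize1.
have DM d p e q : D d p -> D e q -> D (d + e)%N (p * q).
  rewrite /D => dp eq.
  have p0 : p != 0 by rewrite -msize_gt0 (leq_ltn_trans _ dp).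
  have q0 : q != 0 by rewrite -msize_gt0 (leq_ltn_trans _ eq).
  by rewrite msizeM //; lia.
rewrite comp_mpolyX mdegE; change (D (\sum_i m i)%N (\prod_i tnth Y i ^+ m i)).
apply: (big_ind2 _ D1 DM) => i _.
elim: (m i) => [|e IHe]; first by rewrite expr0.
by rewrite exprS; apply: (DM 1%N _ e) => //; apply: Ysz.
Qed.

Lemma ltn_msize_comp_mnm m m' : (m <= m')%MM -> m != m' ->
  (msize ('X_[R, m] \mPo Y) < msize ('X_[R, m'] \mPo Y))%N.
Proof.
move=> /submK e mm'; have dX := msize_comp_mnm.
have X0 q : 'X_[q] \mPo Y != 0.
  by rewrite -msize_gt0 (leq_ltn_trans _ (dX q)).
have d0 : mdeg (m' - m) != 0%N.
  by rewrite mdeg_eq0; apply: contraNneq mm' => d0; rewrite -e d0 add0m.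
have lt_nat a b d : (d != 0 -> d < b -> a < (b + a).-1)%N by lia.
rewrite -e mpolyXD comp_mpolyM msizeM //.
exact: lt_nat d0 (dX _).
Qed.

Lemma mnm_le_diag (m m' : 'X_{1..n}) : diag_shift m m' ->
  (mdeg m <= mdeg m')%N -> (m <= m')%MM.
Proof.
move=> diag; rewrite !mdegE => le_mm'; apply/mnm_lepP => i.
rewrite leqNgt; apply: contraL le_mm' => lt_i.
rewrite -ltnNge (bigD1 i) //= [ltnRHS](bigD1 i) //=.
rewrite -addSn leq_add // leq_sum // => j _; have := diag i j; lia.
Qed.

(** Exponents differing by multiples of (1, ..., 1) form a chain, so distinct
    monomials of p acquire distinct degrees under the substitution and the
    leading one cannot be cancelled. *)
Lemma leq_msize_comp p :
  {in msupp p &, forall m m', diag_shift m m'} ->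
  (msize p <= msize (p \mPo Y))%N.
Proof.
have [->|p0 diag] := eqVneq p 0; first by rewrite mmeasure0.
have Lp := mlead_supp p0; rewrite -mlead_deg //; set L := mlead p in Lp *.
apply: leq_trans (msize_comp_mnm L) _.
rewrite -(@msizeZ _ _ p@_L) -?mcoeff_msupp //.
have sp : p \mPo Y = p@_L *: ('X_[L] \mPo Y) +
    \sum_(m <- msupp p | m != L) p@_m *: ('X_[m] \mPo Y).
  by rewrite comp_mpolyEX (bigD1_seq L).
have lt_rest : (msize (\sum_(m <- msupp p | m != L) p@_m *: ('X_[m] \mPo Y)) <
    msize (p@_L *: ('X_[L] \mPo Y)))%N.
  rewrite [ltnRHS]msizeZ -?mcoeff_msupp // big_seq_cond.
  apply: leq_ltn_trans (mmeasure_sum _ _ _ _) _.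
  have szL := leq_ltn_trans (leq0n _) (msize_comp_mnm L).
  rewrite -(prednK szL) ltnS; apply/bigmax_leqP_seq => m mp /andP[_ mL].
  apply: leq_trans (msizeZ_le _ _) _; rewrite -ltnS prednK //.
  apply: ltn_msize_comp_mnm => //; apply: mnm_le_diag; first exact: diag.
  by rewrite -ltnS mlead_deg // msize_mdeg_lt.
rewrite leqNgt; apply/negP => lt_L.
have := mmeasureD_le (Measure.clone _ mdeg _) (p \mPo Y)
  (- \sum_(m <- msupp p | m != L) p@_m *: ('X_[m] \mPo Y)).
by rewrite {1}sp addrK mmeasureN leqNgt gtn_max lt_L lt_rest.
Qed.

End Degrees.

(** With at least two variables, neither two variables nor a variable and a
    constant have exponents differing by a multiple of (1, ..., 1). *)
Lemma diag_support_linear (n : nat) (R : idomainType) (p : {mpoly R[n.+2]}) :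
  {in msupp p &, forall m m', diag_shift m m'} ->
  msize p = 2%N -> exists2 k, k != 0 & exists i, p = k *: 'X_i.
Proof.
move=> diag sz; have p0 : p != 0 by rewrite -msize_poly_eq0 sz.
have Lp := mlead_supp p0; set L := mlead p in Lp.
have /eqP/mdeg1P[i /eqP Li] : mdeg L = 1%N.
  by apply: succn_inj; rewrite mlead_deg.
exists p@_L; first by rewrite -mcoeff_msupp.
exists i; apply/mpolyP => m; rewrite mcoeffZ mcoeffX Li.
have [<-|/eqP mi] := eqVneq; first by rewrite mulr1.
rewrite mulr0; apply: memN_msupp_eq0; apply/negP => mp.
have le_m : (m <= U_(i))%MM.
  apply: mnm_le_diag; first by rewrite -Li; apply: diag.
  by rewrite mdeg1 -ltnS -sz msize_mdeg_lt.
have mj j : j != i -> m j = 0%N.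
  move=> ji; have /mnm_lepP/(_ j) := le_m; rewrite mnm1E eq_sym (negbTE ji).
  by rewrite leqn0 => /eqP.
have [j ji] : exists j, j != i.
  by have [->|i0] := eqVneq i 0; [exists 1 | exists 0; rewrite eq_sym].
have := diag _ _ mp Lp i j.
rewrite Li !mnm1E eqxx eq_sym (negbTE ji) (mj j) // addn0 add0n.
move=> mi1; case: mi; apply/mnmP => l; rewrite mnm1E.
by case: eqP => [<-|/eqP li]; rewrite ?mi1 // mj // eq_sym.
Qed.

(** * The elliptic bracket *)

Section EllipticBracket.
Variables (K : fieldType) (alpha : K).
Implicit Types (a b c : elliptic alpha) (k : K).

(** Left linearity and {a, a} = 0 alone do not give antisymmetry, so it is read
    off the determinant. *)
Lemma ell_bracketC a b : pbracket a b = - pbracket b a.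
Proof. rewrite /pbracket /= /elliptic_bracket !jacobian3E; ring. Qed.

Lemma ell_bracket_linl k a b c :
  pbracket (k *: a + b) c = k *: pbracket a c + pbracket b c.
Proof. exact: (pbracket_linearl c). Qed.

Lemma ell_bracket_linr k a b c :
  pbracket c (k *: a + b) = k *: pbracket c a + pbracket c b.
Proof.
by rewrite !(ell_bracketC c) ell_bracket_linl opprD scalerN.
Qed.

Lemma ell_bracketZl k a b : pbracket (k *: a) b = k *: pbracket a b.
Proof.
have b0 : pbracket 0 b = 0.
  by have := ell_bracket_linl (-1) 0 0 b; rewrite scaler0 addr0 scaleN1r addNr.
by have := ell_bracket_linl k a 0 b; rewrite b0 !addr0.
Qed.

Lemma ell_bracketZr k a b : pbracket a (k *: b) = k *: pbracket a b.
Proof. by rewrite !(ell_bracketC a) ell_bracketZl scalerN. Qed.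

Lemma ell_bracketMr a b c :
  pbracket c (a * b) = a * pbracket c b + pbracket c a * b.
Proof.
by rewrite !(ell_bracketC c) pbracketMl opprD mulrN mulNr.
Qed.

Lemma ell_bracket1l c : pbracket 1 c = 0.
Proof.
have := pbracketMl (1 : elliptic alpha) 1 c.
by rewrite !mul1r mulr1 => /(canLR (addrK _)); rewrite subrr.
Qed.

Lemma ell_bracket1r c : pbracket c 1 = 0.
Proof. by rewrite ell_bracketC ell_bracket1l oppr0. Qed.

End EllipticBracket.

(** * The coordinates u, v, w *)

Section Coordinates.
Variables (K : fieldType) (alpha eps : K).
Hypotheses (K3 : 3 != 0 :> K) (alpha3 : alpha ^+ 3 = 1).
Hypothesis eps_root : eps ^+ 2 + eps + 1 = 0.
Local Notation A := (elliptic alpha).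

Definition uvw (i : 'I_3) : A :=
  nth 0 [:: ell_u alpha; ell_v alpha eps; ell_w alpha eps] i.

(** Polynomials in formal variables, as opposed to elements of the Poisson
    algebra, carry the expressions in u, v, w: the monomial analysis takes
    place there. *)
Definition of_uvw (p : {mpoly K[3]}) : A :=
  p \mPo [tuple (uvw i : {mpoly K[3]}) | i < 3].

(** The discrete Fourier inverse of the formulas for u, v, w; note that
    alpha ^ 2 is the inverse of alpha. *)
Definition xyz_of_uvw (i : 'I_3) : {mpoly K[3]} :=
  nth 0 [:: 3^-1 *: ('X_0 + eps ^+ 2 *: 'X_1 + eps *: 'X_2);
            3^-1 *: ('X_0 + eps *: 'X_1 + eps ^+ 2 *: 'X_2);
            (3^-1 * alpha ^+ 2) *: ('X_0 + 'X_1 + 'X_2)] i.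

Definition to_uvw (a : A) : {mpoly K[3]} :=
  (a : {mpoly K[3]}) \mPo [tuple xyz_of_uvw i | i < 3].

Lemma of_uvwX i : of_uvw 'X_i = uvw i.
Proof. exact: comp_mpolyXi. Qed.

Lemma of_uvw1 : of_uvw 1 = 1.
Proof. exact: comp_mpoly1. Qed.

Lemma of_uvw_lin k p q : of_uvw (k *: p + q) = k *: of_uvw p + of_uvw q.
Proof. by rewrite /of_uvw comp_mpolyD comp_mpolyZ. Qed.

Lemma of_uvwM p q : of_uvw (p * q) = of_uvw p * of_uvw q.
Proof. exact: comp_mpolyM. Qed.

Lemma to_uvw1 : to_uvw 1 = 1.
Proof. exact: comp_mpoly1. Qed.

Lemma to_uvw_lin k a b : to_uvw (k *: a + b) = k *: to_uvw a + to_uvw b.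
Proof. by rewrite /to_uvw [LHS]comp_mpolyD comp_mpolyZ. Qed.

Lemma to_uvwM a b : to_uvw (a * b) = to_uvw a * to_uvw b.
Proof. exact: comp_mpolyM. Qed.

Lemma ord3P (P : 'I_3 -> Prop) : P 0 -> P 1 -> P 2 -> forall i, P i.
Proof.
move=> P0 P1 P2 [[|[|[|//]]] i3].
- by rewrite (_ : Ordinal i3 = 0) //; apply: val_inj.
- by rewrite (_ : Ordinal i3 = 1) //; apply: val_inj.
- by rewrite (_ : Ordinal i3 = 2) //; apply: val_inj.
Qed.

Lemma eps_sqr : eps ^+ 2 = - eps - 1.
Proof. by rewrite -[LHS]subr0 -eps_root; ring. Qed.

Lemma ord3_cases (j i : 'I_3) : [\/ i = j, i = j + 1 | i = j - 1].
Proof.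
elim/ord3P: j; elim/ord3P: i.
all: by [apply: Or31 | apply: Or32; apply: val_inj
        | apply: Or33; apply: val_inj].
Qed.

Lemma polyC_relations :
  [/\ (3^-1)%:MP * 3 = 1 :> {mpoly K[3]}, alpha%:MP ^+ 3 = 1 :> {mpoly K[3]}
    & eps%:MP ^+ 2 = - eps%:MP - 1 :> {mpoly K[3]}].
Proof.
have C3 : (3 : K)%:MP = 3 :> {mpoly K[3]} by rewrite mpolyC_nat.
split.
- by rewrite -C3 -mpolyCM mulVf // mpolyC1.
- by rewrite -rmorphXn /= alpha3 mpolyC1.
- by rewrite -rmorphXn /= -mpolyCN -mpolyC1 -mpolyCB eps_sqr.
Qed.

Lemma to_uvw_uvw i : to_uvw (uvw i) = 'X_i.
Proof.
have [C3 A3 E2] := polyC_relations.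
have X k : to_uvw ('X_k : {mpoly K[3]}) = xyz_of_uvw k by exact: comp_mpolyXi.
have lin k l : to_uvw (k + l) = to_uvw k + to_uvw l by exact: comp_mpolyD.
have sc k l : to_uvw (k *: l) = k *: to_uvw l by exact: comp_mpolyZ.
elim/ord3P: i; rewrite /uvw /= /ell_u /ell_v /ell_w /ell_x /ell_y /ell_z.
all: rewrite !lin ?sc !X /xyz_of_uvw /=.
all: rewrite -!mul_mpolyC ?mpolyCM ?expr2 ?mpolyCM -?expr2.
all: ring: C3 A3 E2.
Qed.

Lemma of_uvw_xyz i : of_uvw (xyz_of_uvw i) = 'X_i :> {mpoly K[3]}.
Proof.
have [C3 A3 E2] := polyC_relations.
have lin k l : of_uvw (k + l) = of_uvw k + of_uvw l by exact: comp_mpolyD.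
have sc k l : of_uvw (k *: l) = k *: of_uvw l by exact: comp_mpolyZ.
elim/ord3P: i; rewrite /xyz_of_uvw /= !(lin, sc) !of_uvwX /uvw /=.
all: rewrite /ell_u /ell_v /ell_w /ell_x /ell_y /ell_z.
all: rewrite -!mul_mpolyC ?mpolyCM ?expr2 ?mpolyCM -?expr2.
all: ring: C3 A3 E2.
Qed.

Lemma of_uvwK : cancel of_uvw to_uvw.
Proof.
apply: mpoly_alg_ind => [|k p q ep eq|p q ep eq|i].
- by rewrite of_uvw1 to_uvw1.
- by rewrite of_uvw_lin to_uvw_lin ep eq.
- by rewrite of_uvwM to_uvwM ep eq.
- by rewrite of_uvwX to_uvw_uvw.
Qed.

Lemma to_uvwK : cancel to_uvw of_uvw.
Proof.
apply: mpoly_alg_ind => [|k p q ep eq|p q ep eq|i].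
- by rewrite to_uvw1 of_uvw1.
- by rewrite (to_uvw_lin k p q) of_uvw_lin ep eq.
- by rewrite (to_uvwM p q) of_uvwM ep eq.
- by rewrite /to_uvw comp_mpolyXi of_uvw_xyz.
Qed.

Lemma uvw_ind (P : A -> Prop) :
  P 1 -> (forall k a b, P a -> P b -> P (k *: a + b)) ->
  (forall a b, P a -> P b -> P (a * b)) -> (forall i, P (uvw i)) ->
  forall a, P a.
Proof.
move=> P1 PD PM PX a; rewrite -[a]to_uvwK.
elim/mpoly_alg_ind: (to_uvw a) => [|k p q|p q|i].
- by rewrite of_uvw1.
- by rewrite of_uvw_lin; apply: PD.
- by rewrite of_uvwM; apply: PM.
- by rewrite of_uvwX.
Qed.

Lemma msize_uvw i : (msize (uvw i : {mpoly K[3]}) <= 2)%N.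
Proof.
have sz1 (j : 'I_3) : (msize ('X_j : {mpoly K[3]}) <= 2)%N.
  by rewrite msizeX mdeg1.
have szD (p q : {mpoly K[3]}) :
    (msize p <= 2 -> msize q <= 2 -> msize (p + q) <= 2)%N.
  by move=> p2 q2; rewrite (leq_trans (mmeasureD_le _ _ _)) // geq_max p2.
have szZ k (p : {mpoly K[3]}) : (msize p <= 2 -> msize (k *: p) <= 2)%N.
  exact: leq_trans (msizeZ_le _ _).
elim/ord3P: i; rewrite /uvw /= /ell_u /ell_v /ell_w.
all: by do ![apply: (szD _ _) | apply: (szZ _ _) | exact: sz1].
Qed.

Definition bracket_cst : K := alpha * (eps ^+ 2 - eps).

(** Indeed c ^ 2 = -3 alpha ^ 2. *)
Lemma bracket_cst_neq0 : bracket_cst != 0.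
Proof.
have e2 := eps_sqr.
apply: contra K3 => /eqP c0; apply/eqP.
have -> : 3 = - bracket_cst ^+ 2 * alpha.
  rewrite /bracket_cst; ring: alpha3 e2.
by rewrite c0 expr0n /= oppr0 mul0r.
Qed.

(** {u, v} = J(u, v, w) dC/dw with C = u v w / 3, and c is J(u, v, w) / 3; it is
    checked here on the brackets of x, y, z. *)
Lemma uvw_bracket i :
  pbracket (uvw i) (uvw (i + 1)) = bracket_cst *: (uvw i * uvw (i + 1)).
Proof.
have [bxy byz bzx] := elliptic_bracket_gens alpha K3.
have [C3 A3 E2] := polyC_relations.
have bl (a1 b1 c1 a2 b2 c2 : K) :
    let x := ell_x alpha in let y := ell_y alpha in let z := ell_z alpha in
    pbracket (a1 *: x + (b1 *: y + c1 *: z)) (a2 *: x + (b2 *: y + c2 *: z)) =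
    (a1 * b2 - b1 * a2) *: pbracket x y + (b1 * c2 - c1 * b2) *: pbracket y z
    + (c1 * a2 - a1 * c2) *: pbracket z x.
  move=> x y z; rewrite !(ell_bracket_linl, ell_bracket_linr).
  rewrite !(ell_bracketZl, ell_bracketZr) !pbracketxx.
  rewrite (ell_bracketC y x) (ell_bracketC z y) (ell_bracketC x z).
  rewrite -!mul_mpolyC !(mpolyCB, mpolyCM); ring.
have e2 := eps_sqr.
have uE : ell_u alpha =
    1 *: ell_x alpha + (1 *: ell_y alpha + alpha *: ell_z alpha).
  by rewrite !scale1r addrA.
elim/ord3P: i; rewrite /uvw /= /ell_v /ell_w ?uE -!addrA bl bxy byz bzx.
all: rewrite /bracket_cst -!mul_mpolyC !e2 /ell_x /ell_y /ell_z.
all: rewrite !(mpolyCB, mpolyCM, mpolyCN, mpolyC1).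
all: ring: A3 E2.
Qed.

(** The derivation multiplying a monomial by its degree in X_(j-1) minus its
    degree in X_(j+1). *)
Definition euler_diff (j : 'I_3) (p : {mpoly K[3]}) : {mpoly K[3]} :=
  'X_(j - 1) * p^`M(j - 1) - 'X_(j + 1) * p^`M(j + 1).

Lemma bracket_of_uvw p j : pbracket (of_uvw p) (uvw j) =
  bracket_cst *: (uvw j * of_uvw (euler_diff j p)).
Proof.
move: p; apply: mpoly_alg_ind => [|k p q ep eq|p q ep eq|i].
- rewrite of_uvw1 ell_bracket1l /euler_diff !mderivC !mulr0 subrr.
  by rewrite [of_uvw 0]comp_mpoly0 mulr0 scaler0.
- rewrite of_uvw_lin ell_bracket_linl ep eq.
  have -> : euler_diff j (k *: p + q) = k *: euler_diff j p + euler_diff j q.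
    by rewrite /euler_diff !(mderivD, mderivZ) -!mul_mpolyC; ring.
  by rewrite of_uvw_lin -!mul_mpolyC; ring.
- rewrite of_uvwM pbracketMl ep eq.
  have -> : euler_diff j (p * q) = p * euler_diff j q + euler_diff j p * q.
    by rewrite /euler_diff !mderivM; ring.
  have -> : of_uvw (p * euler_diff j q + euler_diff j p * q) =
     of_uvw p * of_uvw (euler_diff j q) + of_uvw (euler_diff j p) * of_uvw q.
    by rewrite -!of_uvwM [LHS]comp_mpolyD.
  by rewrite -!mul_mpolyC; ring.
- have [jm jp mp] : [/\ (j == j - 1) = false, (j == j + 1) = false
                      & (j - 1 == j + 1) = false].
    by elim/ord3P: j.
  rewrite of_uvwX /euler_diff !mderiv_var.
  have [->|->|->] := ord3_cases j i.
  + rewrite pbracketxx jm jp !mulr0 subrr.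
    by rewrite [of_uvw 0]comp_mpoly0 mulr0 scaler0.
  + rewrite ell_bracketC uvw_bracket eqxx [j + 1 == _]eq_sym mp.
    rewrite mulr0 mulr1 sub0r.
    by rewrite [of_uvw _]comp_mpolyN [_ \mPo _]of_uvwX mulrN scalerN.
  + have := uvw_bracket (j - 1); rewrite subrK => ->.
    by rewrite eqxx mp mulr0 mulr1 subr0 of_uvwX mulrC.
Qed.
End Coordinates.

(** * Automorphisms permute the coordinates up to scalars *)

Section Normal.
Variables (K : fieldType) (charK : [pchar K] =i pred0) (alpha eps : K).
Hypotheses (alpha3 : alpha ^+ 3 = 1) (eps_root : eps ^+ 2 + eps + 1 = 0).
Local Notation A := (elliptic alpha).
Local Notation uvw := (uvw alpha eps).
Local Notation of_uvw := (of_uvw alpha eps).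
Local Notation to_uvw := (@to_uvw K alpha eps).
Local Notation c := (bracket_cst alpha eps).

Let K3 : 3 != 0 :> K.
Proof. by rewrite ((pcharf0P K).1 charK). Qed.

Let c0 : c != 0 := bracket_cst_neq0 K3 alpha3 eps_root.

Lemma mcoeff_euler_diff j m (p : {mpoly K[3]}) :
  (euler_diff j p)@_m = p@_m * ((m (j - 1))%:R - (m (j + 1))%:R).
Proof. by rewrite mcoeffB !mcoeff_euler mulrBr !mulr_natr. Qed.

Lemma msize_euler_diff j (p : {mpoly K[3]}) :
  (msize (euler_diff j p) <= msize p)%N.
Proof.
rewrite {1}msizeE; apply/bigmax_leqP_seq => m.
rewrite mcoeff_msupp mcoeff_euler_diff => mp _; apply: msize_mdeg_lt.
by rewrite mcoeff_msupp; apply: contraNneq mp => ->; rewrite mul0r.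
Qed.

Lemma euler_diff_varM j (p : {mpoly K[3]}) :
  euler_diff j ('X_j * p) = 'X_j * euler_diff j p.
Proof.
rewrite /euler_diff !mderivM !mderiv_var.
have [-> ->] : (j == j - 1) = false /\ (j == j + 1) = false by elim/ord3P: j.
by rewrite !mulr0n; ring.
Qed.

(** Each coordinate generates a Poisson ideal. *)
Lemma uvw_normal i (b : A) : exists g, pbracket (uvw i) b = uvw i * g.
Proof.
elim/(uvw_ind K3 alpha3 eps_root): b =>
  [|k a b [g eg] [h eh]|a b [g eg] [h eh]|j].
- by exists 0; rewrite ell_bracket1r mulr0.
- exists (k *: g + h).
  by rewrite ell_bracket_linr eg eh mulrDr scalerAr.
- by exists (a * h + g * b); rewrite ell_bracketMr eg eh; ring.
- have [->|->|->] := ord3_cases i j.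
  + by exists 0; rewrite pbracketxx mulr0.
  + by exists (c *: uvw (i + 1)); rewrite uvw_bracket // -scalerAr.
  + exists (- (c *: uvw (i - 1))); rewrite ell_bracketC.
    have := uvw_bracket K3 alpha3 eps_root (i - 1); rewrite subrK => ->.
    by rewrite mulrN mulrC -scalerAr.
Qed.

(** Dividing {p, t j} by p makes p an eigenvector of each of the three
    derivations, whose eigenvalues on monomials are differences of two
    exponents. *)
Lemma normal_diag (p : {mpoly K[3]}) :
  (forall b, exists g, pbracket (of_uvw p) b = of_uvw p * g) ->
  {in msupp p &, forall m m', diag_shift m m'}.
Proof.
move=> pN m m' mp m'p.
have step (j : 'I_3) :
    (m (j - 1)%R + m' (j + 1)%R = m (j + 1)%R + m' (j - 1)%R)%N.
  have [g pg] := pN (uvw j).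
  have [|k ek] := var_dvd_eigenvector (@euler_diff_varM j) (@msize_euler_diff j)
                    (p := p) (g := c^-1 *: to_uvw g).
    apply: (can_inj (of_uvwK K3 alpha3 eps_root)); apply: (scalerI c0).
    rewrite -scalerAr [of_uvw (_ *: _)]comp_mpolyZ scalerA mulfV // scale1r.
    rewrite -/(of_uvw _) !of_uvwM to_uvwK // -pg.
    rewrite (bracket_of_uvw K3 alpha3 eps_root).
    by rewrite of_uvwX.
  have wt q : q \in msupp p -> (q (j - 1)%R)%:R - (q (j + 1)%R)%:R = k.
    rewrite mcoeff_msupp => q0; apply: (mulfI q0).
    by rewrite -mcoeff_euler_diff ek mcoeffZ mulrC.
  have /eqP := etrans (wt m mp) (esym (wt m' m'p)).
  rewrite subr_eq addrAC eq_sym subr_eq -!natrD.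
  have inj (a b : nat) : a%:R == b%:R :> K -> a = b.
    wlog le_ab : a b / (a <= b)%N.
      move=> H; case/orP: (leq_total a b) => [/H //|/H].
      by rewrite eq_sym => {}H /H.
    rewrite eq_sym -subr_eq0 -natrB // ((pcharf0P K).1 charK); lia.
  by move/inj; lia.
move=> i j; have [->|->|->] := ord3_cases i j; first by [].
- have e : (i - 1 - 1 = i + 1)%R by elim/ord3P: i; apply: val_inj.
  by have := step (i - 1); rewrite e subrK; lia.
- have e : (i + 1 + 1 = i - 1)%R by elim/ord3P: i; apply: val_inj.
  by have := step (i + 1); rewrite e addrK; lia.
Qed.

Section Automorphism.
Variable phi : poisson_aut A.

Lemma aut_lin k a b : phi (k *: a + b) = k *: phi a + phi b.
Proof. by have [_ l _ _] := poisson_autP phi; apply: l. Qed.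

Lemma autM a b : phi (a * b) = phi a * phi b.
Proof. by have [_ _ m _] := poisson_autP phi; apply: m. Qed.

Lemma aut_bracket a b : phi (pbracket a b) = pbracket (phi a) (phi b).
Proof. by have [_ _ _ m] := poisson_autP phi; apply: m. Qed.

Lemma aut_inj : injective phi.
Proof. by have [/bij_inj] := poisson_autP phi. Qed.

Lemma aut1 : phi 1 = 1.
Proof.
have [[g _ gK] _ _ _] := poisson_autP phi.
by rewrite -[LHS]mulr1 -{2}[1]gK -autM mul1r gK.
Qed.

Lemma autZ k a : phi (k *: a) = k *: phi a.
Proof.
have phi0 : phi 0 = 0.
  by have := aut_lin (-1) 0 0; rewrite scaler0 addr0 scaleN1r addNr.
by have := aut_lin k a 0; rewrite phi0 !addr0.
Qed.

Lemma aut_of_uvw p :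
  phi (of_uvw p) = p \mPo [tuple (phi (uvw k) : {mpoly K[3]}) | k < 3].
Proof.
move: p; apply: mpoly_alg_ind => [|k p q ep eq|p q ep eq|i].
- by rewrite of_uvw1 aut1 comp_mpoly1.
- by rewrite of_uvw_lin aut_lin ep eq comp_mpolyD comp_mpolyZ.
- by rewrite of_uvwM autM ep eq comp_mpolyM.
- by rewrite of_uvwX comp_mpolyXi.
Qed.

Lemma uvw_neq_cst k i : uvw i <> k *: 1.
Proof.
move=> /(congr1 to_uvw); rewrite to_uvw_uvw //.
rewrite [RHS]comp_mpolyZ comp_mpoly1 => e.
have := msizeX K U_(i)%MM; rewrite e mdeg1 => sz.
by have := msizeZ_le (1 : {mpoly K[3]}) k; rewrite sz msize1.
Qed.

Lemma aut_uvw_nonconstant i : (1 < msize (phi (uvw i) : {mpoly K[3]}))%N.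
Proof.
rewrite ltnNge; apply/negP => /msize1_polyC e.
apply: (@uvw_neq_cst (phi (uvw i))@_0%MM i); apply: aut_inj.
by rewrite autZ aut1 -mul_mpolyC mulr1.
Qed.

End Automorphism.

(** The degree of p = phi (t i), expressed in u, v, w, is bounded through the
    inverse psi of phi: substituting the psi (t k) in p gives back t i, which
    has degree 1. *)
Lemma aut_uvw (phi : poisson_aut A) i :
  exists2 k, k != 0 & exists j, phi (uvw i) = k *: uvw j.
Proof.
pose psi := poisson_aut_inv phi.
have phiK : cancel phi psi := @poisson_autK _ _ phi.
have psiK : cancel psi phi := @poisson_aut_invfK _ _ phi.
pose p := to_uvw (phi (uvw i)).
have pE : of_uvw p = phi (uvw i) by rewrite /p to_uvwK.
have diag : {in msupp p &, forall m m', diag_shift m m'}.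
  apply: normal_diag => b; have [g eg] := uvw_normal i (psi b).
  by exists (phi g); rewrite pE -autM -eg aut_bracket psiK.
have sz : msize p = 2%N.
  apply/eqP; rewrite eqn_leq; apply/andP; split.
    apply: leq_trans (msize_uvw alpha eps i).
    rewrite -[uvw i]phiK -pE aut_of_uvw; apply: leq_msize_comp diag => k.
    by rewrite tnth_mktuple aut_uvw_nonconstant.
  rewrite ltnNge; apply/negP => /msize1_polyC e.
  apply: (@uvw_neq_cst p@_0%MM i); apply: (@aut_inj phi).
  rewrite autZ aut1 -pE {1}e -[_%:MP]mulr1 mul_mpolyC.
  by rewrite [LHS]comp_mpolyZ comp_mpoly1.
have [k k0 [j ej]] := diag_support_linear diag sz.
exists k => //; exists j; rewrite -pE ej [LHS]comp_mpolyZ.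
by congr (_ *: _); apply: of_uvwX.
Qed.

Lemma uvw_neq0 i : uvw i != 0.
Proof. by apply/eqP => e; apply: (@uvw_neq_cst 0 i); rewrite scale0r. Qed.

Lemma aut_uvw_cyclic (phi : poisson_aut A) : exists (n : 'I_3 -> K) (h : 'I_3),
  forall i, n (i + h) != 0 /\ phi (uvw i) = n (i + h) *: uvw (i + h).
Proof.
have H i : exists kj : K * 'I_3, kj.1 != 0 /\ phi (uvw i) = kj.1 *: uvw kj.2.
  by have [k k0 [j e]] := aut_uvw phi i; exists (k, j).
have {H}[f fP] := choice H.
have nxt i : (f (i + 1)).2 = (f i).2 + 1.
  have [ki0 ei] := fP i; have [kj0 ej] := fP (i + 1).
  have := uvw_bracket K3 alpha3 eps_root i => /(congr1 phi).
  rewrite aut_bracket autZ autM ei ej.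
  move: (f i).1 (f i).2 (f (i + 1)).1 (f (i + 1)).2 ki0 kj0 => k r l s k0 l0.
  have swap (x : A) : c *: (k *: (l *: x)) = k *: (l *: (c *: x)).
    by rewrite !scalerA; congr (_ *: _); ring.
  rewrite ell_bracketZl ell_bracketZr -scalerAl -scalerAr swap.
  move=> /(scalerI k0) /(scalerI l0).
  have nz a : a != 0 :> K -> a *: (uvw r * uvw s) != 0.
    move=> a0; rewrite scaler_eq0 (negPf a0) /= [_ == _]mulf_eq0.
    by rewrite !(negPf (uvw_neq0 _)).
  (* The index s is r, r + 1 or r - 1, where the bracket of t r and t s is
     0, c or -c times their product; only c is compatible with phi. *)
  have [es|-> //|es] := ord3_cases r s; rewrite es in nz *; move=> /esym/eqP.
    by rewrite pbracketxx; have /negPf -> := nz c c0.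
  have := uvw_bracket K3 alpha3 eps_root (r - 1).
  rewrite subrK ell_bracketC => /(canRL (@opprK _)) ->.
  rewrite [uvw (r - 1) * _]mulrC -subr_eq0 opprK -scalerDl.
  have cc0 : c + c != 0.
    by rewrite -mulr2n -mulr_natl mulf_neq0 // ((pcharf0P K).1 charK).
  by have /negPf -> := nz _ cc0.
exists (fun j => (f (j - (f 0).2)).1), (f 0).2 => i.
have e2 : (f i).2 = i + (f 0).2.
  have f1 : (f 1).2 = (f 0).2 + 1 by rewrite -nxt add0r.
  elim/ord3P: i; rewrite ?add0r ?f1 1?[1 + _]addrC //.
  have := nxt 1; rewrite f1 -addrA => e.
  by rewrite addrC -[2]/(1 + 1 : 'I_3) -e.
by have := fP i; rewrite e2 addrK.
Qed.
End Normal.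

(** * The monomial automorphisms *)

Section MonomialAutomorphisms.
Variables (K : fieldType) (alpha eps : K).
Hypotheses (K3 : 3 != 0 :> K) (alpha3 : alpha ^+ 3 = 1).
Hypothesis eps_root : eps ^+ 2 + eps + 1 = 0.
Local Notation A := (elliptic alpha).
Local Notation uvw := (uvw alpha eps).

(** The scaling n acts after the cyclic shift by h, in accordance with the
    factor order (n, h) = (n, 1) (1, h) of the semidirect product. *)
Definition monomial_map (n : 'I_3 -> K) (h : 'I_3) (a : A) : A :=
  to_uvw eps a \mPo [tuple (n (i + h) *: uvw (i + h) : {mpoly K[3]}) | i < 3].

Lemma monomial_map_uvw n h i :
  monomial_map n h (uvw i) = n (i + h) *: uvw (i + h).
Proof. by rewrite /monomial_map to_uvw_uvw // comp_mpolyXi. Qed.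

Lemma monomial_map1 n h : monomial_map n h 1 = 1.
Proof. by rewrite /monomial_map to_uvw1 comp_mpoly1. Qed.

Lemma monomial_map_lin n h : linear (monomial_map n h).
Proof.
by move=> k a b; rewrite /monomial_map to_uvw_lin comp_mpolyD comp_mpolyZ.
Qed.

Lemma monomial_mapD n h : {morph monomial_map n h : a b / a + b}.
Proof.
by move=> a b; have := monomial_map_lin n h 1 a b; rewrite !scale1r.
Qed.

Lemma monomial_mapZ n h k a :
  monomial_map n h (k *: a) = k *: monomial_map n h a.
Proof. by rewrite /monomial_map [to_uvw _ _]comp_mpolyZ comp_mpolyZ. Qed.

Lemma monomial_mapM n h : {morph monomial_map n h : a b / a * b}.
Proof. by move=> a b; rewrite /monomial_map to_uvwM comp_mpolyM. Qed.

Lemma monomial_map_comp n h q l a : monomial_map n h (monomial_map q l a) =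
  monomial_map (fun i => n i * q (i - h)) (l + h) a.
Proof.
elim/(uvw_ind K3 alpha3 eps_root): a => [|k a b ea eb|a b ea eb|i].
- by rewrite !monomial_map1.
- by rewrite !monomial_map_lin ea eb.
- by rewrite !monomial_mapM ea eb.
- rewrite monomial_map_uvw monomial_mapZ !monomial_map_uvw.
  by rewrite scalerA addrA addrK mulrC.
Qed.

Lemma monomial_map_id n a : n =1 (fun=> 1) -> monomial_map n 0 a = a.
Proof.
move=> n1; elim/(uvw_ind K3 alpha3 eps_root): a => [|k a b ea eb|a b ea eb|i].
- by rewrite monomial_map1.
- by rewrite monomial_map_lin ea eb.
- by rewrite monomial_mapM ea eb.
- by rewrite monomial_map_uvw n1 scale1r addr0.
Qed.

(** Both sides are derivations in each argument, so it suffices to compare them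
    on pairs of coordinates, and by antisymmetry on consecutive ones. *)
Lemma monomial_map_bracket n h :
  {morph monomial_map n h : a b / pbracket a b}.
Proof.
have next i : monomial_map n h (pbracket (uvw i) (uvw (i + 1))) =
    pbracket (monomial_map n h (uvw i)) (monomial_map n h (uvw (i + 1))).
  rewrite uvw_bracket // monomial_mapZ monomial_mapM !monomial_map_uvw.
  rewrite ell_bracketZl ell_bracketZr addrAC uvw_bracket // -scalerAl -scalerAr.
  by rewrite !scalerA; congr (_ *: _); ring.
have skew a b : monomial_map n h (pbracket a b) =
    pbracket (monomial_map n h a) (monomial_map n h b) ->
    monomial_map n h (pbracket b a) =
    pbracket (monomial_map n h b) (monomial_map n h a).
  move=> e; rewrite [pbracket b a]ell_bracketC -scaleN1r monomial_mapZ e.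
  rewrite scaleN1r.
  by rewrite [RHS]ell_bracketC.
have zero : monomial_map n h 0 = 0.
  by rewrite /monomial_map [to_uvw _ _]comp_mpoly0 comp_mpoly0.
have gens i b : monomial_map n h (pbracket (uvw i) b) =
    pbracket (monomial_map n h (uvw i)) (monomial_map n h b).
  elim/(uvw_ind K3 alpha3 eps_root): b => [|k a b ea eb|a b ea eb|j].
  - by rewrite monomial_map1 !ell_bracket1r zero.
  - by rewrite monomial_map_lin !ell_bracket_linr monomial_map_lin ea eb.
  - rewrite monomial_mapM !ell_bracketMr monomial_mapD !monomial_mapM.
    by rewrite ea eb.
  - have [->|->|->] := ord3_cases i j.
    + by rewrite !pbracketxx.
    + exact: next.
    + apply: (skew (uvw (i - 1)) (uvw i)).
      by have := next (i - 1); rewrite subrK.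
move=> a b; apply: (skew b a).
elim/(uvw_ind K3 alpha3 eps_root): a => [|k a a' ea eb|a a' ea eb|i].
- by rewrite monomial_map1 !ell_bracket1r zero.
- by rewrite monomial_map_lin !ell_bracket_linr monomial_map_lin ea eb.
- rewrite monomial_mapM !ell_bracketMr monomial_mapD !monomial_mapM.
  by rewrite ea eb.
- exact: skew (gens i b).
Qed.

Lemma is_poisson_aut_monomial n h : (forall i, n i != 0) ->
  is_poisson_aut (monomial_map n h).
Proof.
move=> n0; split;
  [|exact: monomial_map_lin|exact: monomial_mapM|exact: monomial_map_bracket].
exists (monomial_map (fun i => (n (i + h))^-1) (- h)) => a.
- rewrite monomial_map_comp subrr monomial_map_id // => i.
  by rewrite opprK mulVf.
- rewrite monomial_map_comp addNr monomial_map_id // => i.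
  by rewrite subrK mulfV.
Qed.

Local Notation S := (semidirect (cyclic_shift_act (Kstar K))).

Definition monomial_aut (x : S) : poisson_aut A :=
  PoissonAut (is_poisson_aut_monomial x.2 (fun i => valP (x.1 i))).

Lemma monomial_aut_uvw (x : S) i :
  monomial_aut x (uvw i) = val (x.1 (i + x.2)) *: uvw (i + x.2).
Proof. exact: monomial_map_uvw. Qed.

Lemma aut_uvw_ext (phi psi : poisson_aut A) :
  (forall i, phi (uvw i) = psi (uvw i)) -> phi = psi.
Proof.
have alpha0 : alpha != 0.
  by apply: contra_eq_neq alpha3 => ->; rewrite expr0n eq_sym oner_eq0.
move=> e; apply: (elliptic_aut_uvw K3 alpha0 eps_root).
- exact: (e 0).
- exact: (e 1).
- exact: (e 2).
Qed.

Lemma monomial_autM (x y : S) :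
  monomial_aut (x * y)%g = (monomial_aut x * monomial_aut y)%g.
Proof.
apply: aut_uvw_ext => i; rewrite [RHS]/= monomial_aut_uvw.
rewrite monomial_map_comp monomial_map_uvw /=.
have -> : ((x.2 * y.2)%g = y.2 + x.2 :> 'I_3) by rewrite addrC.
by rewrite ffunE /= !ffunE.
Qed.

Lemma monomial_aut1 : monomial_aut 1%g = 1%g.
Proof.
apply: aut_uvw_ext => i; rewrite monomial_aut_uvw /= addr0 ffunE.
by rewrite scale1r.
Qed.

Lemma monomial_aut_inj : injective monomial_aut.
Proof.
move=> x y exy.
have term i : (i + x.2 = i + y.2 :> 'I_3) /\ x.1 (i + x.2) = y.1 (i + y.2).
  have := congr1 (fun f : poisson_aut A => to_uvw eps (f (uvw i))) exy.
  rewrite !monomial_aut_uvw [LHS]comp_mpolyZ [RHS]comp_mpolyZ -!/(to_uvw _ _).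
  rewrite !to_uvw_uvw // => /(congr1 (mcoeff U_((i + x.2)%R)%MM)).
  rewrite !mcoeffZ !mcoeffX !eq_mnm1 eqxx mulr1.
  have [<- | _ /eqP] := eqVneq; first by rewrite mulr1 => /val_inj.
  by rewrite mulr0 (negPf (valP (x.1 _))).
have e2 : x.2 = y.2 by have [/addrI] := term 0.
case: x y e2 term {exy} => [n h] [q l] /= -> term; congr (_, _).
by apply/ffunP => i; have [_] := term (i - l); rewrite subrK.
Qed.

End MonomialAutomorphisms.

(** * Generation and the isomorphism *)

Section Generation.
Variables (K : fieldType).
Local Notation S := (semidirect (cyclic_shift_act (Kstar K))).

Definition scale_at (i : 'Z_3) (g : Kstar K) : S :=
  ([ffun j => if j == i then g else 1%g], 1%g).
Definition shift_by (h : 'Z_3) : S := (1%g, h).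

Lemma shift_byD a b : shift_by (a + b) = (shift_by a * shift_by b)%g.
Proof. by congr (_, _); apply/ffunP => i; rewrite !ffunE /= mulg1. Qed.

Lemma scale_at_conj i g :
  scale_at i g = (shift_by i * scale_at 0 g * (shift_by i)^-1)%g.
Proof.
congr (_, _) => /=; last by rewrite mulg1 mulgV.
by apply/ffunP => j; rewrite !ffunE /= mul1g subr_eq0 invg1 mulg1.
Qed.

(** Every element is a product of scalings of single coordinates and a shift,
    and the former are conjugate under shifts to scalings of the coordinate
    0. *)
Lemma semidirect_generated (P : S -> Prop) :
  P 1%g -> (forall x y, P x -> P y -> P (x * y)%g) ->
  (forall x, P x -> P x^-1%g) -> (forall g, P (scale_at 0 g)) ->
  P (shift_by 1) -> forall x, P x.
Proof.
move=> P1 PM PV Pscale Pshift.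
have PshD a b : P (shift_by a) -> P (shift_by b) -> P (shift_by (a + b)).
  by rewrite shift_byD; apply: PM.
have Psh h : P (shift_by h).
  by elim/ord3P: h => //; apply: (PshD 1 1).
have Psc i g : P (scale_at i g).
  by rewrite scale_at_conj; exact: PM _ _ (PM _ _ _ _) (PV _ _).
case=> n h.
have -> : ((n, h) : S) =
    (scale_at 0 (n 0) * scale_at 1%R (n 1%R) * scale_at 2 (n 2) * shift_by h)%g.
  congr (_, _); last by rewrite /= !mulg1 mul1g.
  apply/ffunP => j; elim/ord3P: j; rewrite !ffunE /= ?mulg1 ?mul1g //.
exact: PM _ _ (PM _ _ (PM _ _ _ _) _) _.
Qed.
End Generation.

Theorem theorem3 (K : fieldType) (charK : [pchar K] =i pred0)
    (alpha eps : K) (alpha3 : alpha ^+ 3 = 1)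
    (eps_root : eps ^+ 2 + eps + 1 = 0) :
  let u := ell_u alpha in
  let v := ell_v alpha eps in
  let w := ell_w alpha eps in
  exists (psi : Kstar K -> poisson_aut (elliptic alpha))
         (sigma' : poisson_aut (elliptic alpha)),
  [/\ forall gamma : Kstar K,
        [/\ psi gamma u = sval gamma *: u, psi gamma v = v & psi gamma w = w],
      [/\ sigma' u = v, sigma' v = w & sigma' w = u],
      generates (fun phi => (exists gamma, phi = psi gamma) \/ phi = sigma')
    & group_isomorphic (poisson_aut (elliptic alpha))
        (semidirect (cyclic_shift_act (Kstar K)))].
Proof.
move=> u v w.
have K3 : 3 != 0 :> K by rewrite ((pcharf0P K).1 charK).
pose F := monomial_aut K3 alpha3 eps_root.
have Fuvw := monomial_aut_uvw K3 alpha3 eps_root.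
have FM := monomial_autM K3 alpha3 eps_root.
have F1 := monomial_aut1 K3 alpha3 eps_root.
have Finj : injective F := @monomial_aut_inj _ _ _ K3 alpha3 eps_root.
have Fsurj phi : exists x, F x = phi.
  have [n [h nh]] := aut_uvw_cyclic charK alpha3 eps_root phi.
  have n0 i : n i != 0 by have [] := nh (i - h); rewrite subrK.
  exists ([ffun i => exist _ (n i) (n0 i)], h).
  apply: (aut_uvw_ext K3 alpha3 eps_root) => i.
  by rewrite Fuvw /= ffunE; have [_ ->] := nh i.
have FV x : F x^-1%g = (F x)^-1%g.
  by apply: (mulgI (F x)); rewrite -FM !mulgV F1.
exists (fun g => F (scale_at 0 g)), (F (shift_by K 1)); split.
- move=> g.
  have scale i := Fuvw (scale_at 0 g) i.
  split; [have := scale 0 | have := scale 1 | have := scale 2];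
    by rewrite /= ffunE addr0 /uvw /= ?scale1r.
- have shift i := Fuvw (shift_by K 1) i.
  split; [have := shift 0 | have := shift 1 | have := shift 2];
    by rewrite /= ffunE /uvw /= ?scale1r.
- move=> H H1 HM HV Hgen phi; have [x <-] := Fsurj phi.
  elim/semidirect_generated: x => [|x y|x|g|].
  + by rewrite [F _]F1.
  + by rewrite [F (_ * _)%g]FM; apply: HM.
  + by rewrite FV; apply: HV.
  + by apply: Hgen; left; exists g.
  + by apply: Hgen; right.
- have [G GK] := choice Fsurj.
  have FK : cancel F G by move=> x; apply: Finj; rewrite GK.
  exists G; first exact: Bijective GK FK.
  by move=> a b; apply: Finj; rewrite [RHS]FM -!/(F _) !GK.
Qed.
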